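(* For all $\delta$ with $2/3<\delta<2$, $$\alpha_\star(\delta)\le 1+\sqrt{1-\frac{(2-\delta)^2}{2}}<2.$$
   Context: Let $G\sim G(n,\tfrac12)$ be the Erdős–Rényi random graph on $n$ vertices with edge probability $\tfrac12$. A querying strategy adaptively asks queries of the form ''is $(u,v)\in E(G)$?'', each query being allowed to depend on the answers to the previous ones. A clique is found when all of its edges have been queried (and answered positively). $\lg$ denotes the base-$2$ logarithm. For $\delta<2$, $\alpha_\star(\delta)$ is the supremum of all $\alpha\le 2$ such that, for all sufficiently large $n$, some strategy using at most $n^\delta$ queries finds a clique of order $\alpha\lg n$ in $G(n,\tfrac12)$ with probability at least $\tfrac12$. Floor and ceiling signs are omitted where not crucial. *)

(* Defs.v *)
From mathcomp Require Import all_boot all_order all_algebra.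
From mathcomp Require Import all_classical all_reals all_analysis.

Set Implicit Arguments.
Unset Strict Implicit.
Unset Printing Implicit Defensive.

Import Order.TTheory GRing.Theory Num.Theory.
Import numFieldNormedType.Exports.
Local Open Scope classical_set_scope.
Local Open Scope ring_scope.

Definition vpairs (n : nat) : {set {set 'I_n}} :=
  [set e : {set 'I_n} | #|e| == 2%N]%SET.

Definition graph (n : nat) : Type :=
  {E : {set {set 'I_n}} | E \subset vpairs n}.

Definition edges (n : nat) (G : graph n) : {set {set 'I_n}} := val G.

(* Always false for u = v, since then [set u; v] is not a pair. *)
Definition adj (n : nat) (G : graph n) (u v : 'I_n) : bool :=
  [set u; v]%SET \in edges G.

(* The probability of the event A in G(n, p). *)
Definition gnp_prob (R : realType) (n : nat) (p : R) (A : pred (graph n)) : R :=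
  \sum_(G : graph n | A G)
    p ^+ #|edges G| * (1 - p) ^+ (#|vpairs n| - #|edges G|).

Lemma gnp_prob_predT (R : realType) (n : nat) (p : R) :
  gnp_prob p (@predT (graph n)) = 1.
Proof.
pose F (E : {set {set 'I_n}}) : R := p ^+ #|E| * (1 - p) ^+ (#|vpairs n| - #|E|).
have -> : gnp_prob p (@predT (graph n)) = \sum_(E : {set {set 'I_n}} | E \subset vpairs n) F E.
  rewrite (reindex_omap (val : graph n -> _) insub) /=; last first.
    by move=> E sE; rewrite insubT.
  by apply: eq_big => [G|//]; rewrite valK (valP G) eqxx.
transitivity ((1 - p + p) ^+ #|vpairs n|); last by rewrite subrK expr1n.
rewrite exprDn.
rewrite (partition_big (fun E : {set {set 'I_n}} => inord #|E| : 'I_#|vpairs n|.+1)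
  xpredT) //=.
apply: eq_bigr => k _.
rewrite -cards_draws -sumr_const; apply: eq_big => [E|E /andP[sE /eqP <-]].
  rewrite !inE; case sE: (E \subset _) => //=.
  by rewrite -val_eqE /= inordK // ltnS subset_leq_card.
by rewrite /F inordK 1?mulrC // ltnS subset_leq_card.
Qed.

(* Decision trees: [Query u v yes no] asks whether uv is an edge and goes on
   with [yes] or [no] according to the answer. *)
Inductive strategy (n : nat) : Type :=
| Stop
| Query (u v : 'I_n) (yes no : strategy n).

Arguments Stop {n}.

(* The number of queries in the worst case. *)
Fixpoint num_queries (n : nat) (s : strategy n) : nat :=
  match s with
  | Stop => 0%N
  | Query _ _ yes no => (maxn (num_queries yes) (num_queries no)).+1
  end.

Fixpoint queried (n : nat) (s : strategy n) (G : graph n) : {set {set 'I_n}} :=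
  match s with
  | Stop => finset.set0
  | Query u v yes no =>
      ([set u; v] |: queried (if adj G u v then yes else no) G)%SET
  end.

Definition finds_clique (n : nat) (s : strategy n) (k : nat) : pred (graph n) :=
  fun G => [exists K : {set 'I_n}, (#|K| == k) &&
    [forall u in K, forall v in K, (u != v) ==>
       (([set u; v]%SET \in queried s G) && adj G u v)]].

Definition lg (R : realType) (x : R) : R := ln x / ln 2.

(* The order alpha * lg n is rounded down (to 0 when alpha < 0); rounding up
   would give the same supremum in [alpha_star]. *)
Definition achievable (R : realType) (delta : R) : set R :=
  [set alpha : R | alpha <= 2 /\
     \forall n \near \oo, exists s : strategy n,
       (num_queries s)%:R <= n%:R `^ delta /\
       2^-1 <= gnp_prob (2^-1 : R)
                 (finds_clique s (Num.truncn (alpha * lg n%:R)))].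

(* Hence [sup] below is the genuine supremum, not its default value. *)
Lemma achievable_has_sup (R : realType) (delta : R) : has_sup (achievable delta).
Proof.
split; last by exists 2 => a [].
exists 0; split=> //; apply: nearW => n; exists Stop; split; first exact: powR_ge0.
rewrite mul0r truncn0.
have -> : finds_clique (@Stop n) 0 = predT.
  apply/funext => G; apply/existsP; exists finset.set0; rewrite cards0 eqxx /=.
  by apply/forall_inP => u; rewrite inE.
by rewrite gnp_prob_predT invf_le1 ?ler1n.
Qed.

Definition alpha_star (R : realType) (delta : R) : R := sup (achievable delta).

(* Main.v *)
Require Import Defs.
From mathcomp Require Import all_boot all_order all_algebra.
From mathcomp Require Import all_classical all_reals all_analysis.
From mathcomp Require Import perm ring lra.
Import Order.TTheory GRing.Theory Num.Theory.
Import numFieldNormedType.Exports.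
Local Open Scope ring_scope.

(* Let K be a clique found by the strategy, k = |K|, and choose in K a matching
   of m edges minimizing the sum of 2^(time of the query). Minimality under
   exchanges shows that each pair between an edge of the matching and an unmatched
   vertex is queried after that edge, and that of the two perfect matchings
   between two edges of the matching, each contains a pair queried after both.
   Given the set W of unmatched vertices and the query times of the m edges, all
   but m^2 of the pairs in K are therefore queried when both of their ends are
   already known, and each of them costs a factor 1/2; a doubling martingale makes
   this precise for adaptive strategies. A union bound over W and the m times
   bounds the probability of success by
   n^(k - 2m) (n^delta + 1)^m 2^(m^2 - k(k - 1)/2), and m = (2 - delta)/2 lg n is
   the optimal choice; 2m <= k is where delta > 2/3 is used. *)

(** * Exchange arguments on a matching of minimal cost *)

Section EarlyMatching.
Local Open Scope nat_scope.

(** Two distinct powers of 2 with exponents below [a] sum to less than [2 ^ a], so [a] cannot exceed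
    both [p] and [q]. *)
Lemma leq_maxn_of_sum_expn2 (a b p q : nat) :
  p != q -> a != p -> a != q -> 2 ^ a + 2 ^ b <= 2 ^ p + 2 ^ q -> a < maxn p q.
Proof.
move=> npq nap naq; apply: contraTltn => max_le.
have {max_le} [pa qa] : p < a /\ q < a.
  by move: max_le; rewrite geq_max => /andP[]; rewrite !ltn_neqAle
    (eq_sym p) (eq_sym q) nap naq => -> ->.
rewrite -ltnNge.
wlog ltpq : p q {nap naq} pa qa npq / p < q => [wl|].
  have [/wl|/wl|eqpq] := ltngtP p q; first exact.
    by rewrite addnC eq_sym; exact.
  by rewrite eqpq eqxx in npq.
have a_gt0 : 0 < a by apply: leq_ltn_trans pa.
apply: (@leq_trans (2 ^ a)); last exact: leq_addr.
apply: (@leq_trans (2 ^ q + 2 ^ q)); first by rewrite ltn_add2r ltn_exp2l.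
by rewrite addnn -mul2n -expnS leq_exp2l.
Qed.

Lemma ex_inj_pairs (V : finType) (K : {set V}) (m : nat) : m.*2 <= #|K| ->
  exists v : {ffun 'I_m * bool -> V}, injectiveb v && [forall x, v x \in K].
Proof.
move=> le_mK.
have le_cK : #|{: 'I_m * bool}| <= #|K|.
  by rewrite card_prod card_ord card_bool muln2.
exists [ffun x => enum_val (widen_ord le_cK (enum_rank x))].
apply/andP; split; last by apply/forallP => x; rewrite ffunE enum_valP.
apply/injectiveP => x y; rewrite !ffunE => /enum_val_inj/(congr1 val)/= /val_inj.
exact: enum_rank_inj.
Qed.

(* A matching of [m] edges is encoded by the injection [v] listing their ends;
   [rung v i] is its [i]-th edge. *)
Definition rung {V : finType} {m : nat} (v : 'I_m * bool -> V) (i : 'I_m) : {set V} :=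
  [set v (i, false); v (i, true)]%SET.

Lemma rungE {V : finType} {m : nat} (v : 'I_m * bool -> V) (i : 'I_m) (b : bool) :
  rung v i = [set v (i, b); v (i, ~~ b)]%SET.
Proof. by case: b; rewrite /rung // finset.setUC. Qed.

Lemma ex_early_matching (V : finType) (K : {set V}) (m : nat) (r : {set V} -> nat) :
    m.*2 <= #|K| ->
    {in [pred q : {set V} | (q \subset K) && (#|q| == 2)] &, injective r} ->
  exists v : 'I_m * bool -> V, [/\ injective v, forall x, v x \in K,
    forall i b w, w \in K -> (forall x, w != v x) ->
      r (rung v i) < r [set w; v (i, b)]%SET
  & forall i j b c, i != j -> r (rung v i) <
      maxn (r [set v (i, b); v (j, c)]%SET) (r [set v (i, ~~ b); v (j, ~~ c)]%SET)].
Proof.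
move=> le_mK r_inj.
have rneq x y x' y' : x \in K -> y \in K -> x' \in K -> y' \in K ->
    x != y -> x' != y' -> x != x' -> x != y' ->
    r [set x; y]%SET != r [set x'; y']%SET.
  move=> xK yK x'K y'K nxy nx'y' nxx' nxy'.
  have PE a b : a \in K -> b \in K -> a != b ->
      [set a; b]%SET \in [pred q : {set V} | (q \subset K) && (#|q| == 2)].
    by move=> aK bK nab; rewrite inE finset.subUset !finset.sub1set aK bK cards2 nab.
  apply/eqP => /r_inj; rewrite !PE // => /(_ isT isT)/setP/(_ x).
  by rewrite !inE eqxx (negPf nxx') (negPf nxy').
have [v0 Pv0] := ex_inj_pairs V K m le_mK.
pose cost (v : 'I_m * bool -> V) := \sum_i 2 ^ r (rung v i).
have [v /andP[/injectiveP v_inj /forallP vK] v_min] :=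
  @arg_minnP _ v0 (fun v => injectiveb v && [forall x, v x \in K])
    (fun v : {ffun _} => cost v) Pv0.
have cost_min (v' : 'I_m * bool -> V) :
    injective v' -> (forall x, v' x \in K) -> cost v <= cost v'.
  move=> v'_inj v'K; have -> : cost v' = cost (finfun v').
    by apply: eq_bigr => i _; rewrite /rung !ffunE.
  apply: v_min; apply/andP; split; last by apply/forallP => x; rewrite ffunE.
  by apply/injectiveP => x y; rewrite !ffunE => /v'_inj.
have vneq x y : (v x != v y) = (x != y) by rewrite (inj_eq v_inj).
exists v; split=> //.
- move=> i b w wK wv.
  (* First exchange: [w] replaces the end of rung [i] opposite to [v (i, b)], which changes only the
     [i]-th term of the cost. *)
  pose v' x := if x == (i, ~~ b) then w else v x.
  have v'_inj : injective v'.
    move=> x y; rewrite /v'; case: eqP => [->|_]; case: eqP => [->|_] //.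
    + by move=> wE; move: (wv y); rewrite wE eqxx.
    + by move=> wE; move: (wv x); rewrite -wE eqxx.
    + exact: v_inj.
  have v'K x : v' x \in K by rewrite /v'; case: ifP.
  have nbb : ~~ b != b by case: (b).
  have := cost_min _ v'_inj v'K.
  rewrite /cost (bigD1 i) //= [X in _ <= X](bigD1 i) //=.
  have -> : \sum_(j | j != i) 2 ^ r (rung v' j) = \sum_(j | j != i) 2 ^ r (rung v j).
    apply: eq_bigr => j nji; congr (2 ^ r _).
    by rewrite /rung /v' !xpair_eqE (negPf nji).
  rewrite leq_add2r leq_exp2l // (rungE v' i (~~ b)) negbK /v' eqxx xpair_eqE eqxx /=.
  rewrite (eq_sym b) (negPf nbb) leq_eqVlt => /orP[|//].
  rewrite eq_sym (negPf (rneq _ _ _ _ _ _ _ _ _ _ _ _)) //.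
  by rewrite vneq xpair_eqE andbF.
- move=> i j b c nij.
  have nbb d : d != ~~ d by case: d.
  (* Second exchange: swapping two ends turns rungs [i] and [j] into one of the two perfect
     matchings between them. *)
  pose v' x := v (tperm (i, ~~ b) (j, c) x).
  have v'_inj : injective v' by move=> x y /v_inj/perm_inj.
  have := cost_min _ v'_inj (fun x => vK _).
  have nji : j != i by rewrite eq_sym.
  rewrite /cost (bigD1 i) //= [X in _ <= X](bigD1 i) //=.
  rewrite (bigD1 j) //= [X in _ <= _ + X](bigD1 j) //=.
  have -> : \sum_(l | (l != i) && (l != j)) 2 ^ r (rung v' l) =
            \sum_(l | (l != i) && (l != j)) 2 ^ r (rung v l).
    apply: eq_bigr => l /andP[nli nlj]; congr (2 ^ r _).
    by rewrite /rung /v' !tpermD // xpair_eqE eq_sym ?(negPf nli) ?(negPf nlj).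
  have -> : rung v' i = [set v (i, b); v (j, c)]%SET.
    by rewrite (rungE _ i b) /v' tpermL tpermD // xpair_eqE ?(negPf nji) // eqxx /= eq_sym.
  have -> : rung v' j = [set v (i, ~~ b); v (j, ~~ c)]%SET.
    by rewrite (rungE _ j c) /v' tpermR tpermD // xpair_eqE ?(negPf nij) // eqxx /=.
  rewrite !addnA leq_add2r => le_cost; apply: leq_maxn_of_sum_expn2 le_cost.
  + by apply: rneq; rewrite ?vneq // xpair_eqE ?(negPf nij) ?eqxx //= (negPf (nbb b)).
  + rewrite eq_sym (rungE _ i b).
    rewrite (finset.setUC [set v (i, b)]%SET [set v (j, c)]%SET).
    by apply: rneq; rewrite ?vneq // xpair_eqE ?(negPf nij) ?(negPf nji) //= (negPf (nbb b)) andbF.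
  + rewrite eq_sym (rungE _ i b).
    rewrite (finset.setUC [set v (i, ~~ b)]%SET [set v (j, ~~ c)]%SET).
    by apply: rneq; rewrite ?vneq // xpair_eqE ?(negPf nij) ?(negPf nji) //= (negPf (nbb b)) andbF.
Qed.

End EarlyMatching.

(** * A doubling martingale along decision trees *)

Section Betting.
Local Open Scope nat_scope.
Context {n : nat}.
Implicit Types (s : strategy n) (G : graph n) (e q : {set 'I_n}) (l : seq {set 'I_n}).

Fixpoint trace s G : seq {set 'I_n} :=
  match s with
  | Stop => [::]
  | Query u v yes no => [set u; v]%SET :: trace (if adj G u v then yes else no) G
  end.

Lemma mem_trace s G e : (e \in trace s G) = (e \in queried s G).
Proof.
elim: s => [|u v yes IHy no IHn] /=; first by rewrite !inE.
by rewrite !inE; case: adj; rewrite ?IHy ?IHn.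
Qed.

Lemma size_trace s G : size (trace s G) <= num_queries s.
Proof.
elim: s => [|u v yes IHy no IHn] //=; rewrite ltnS leq_max.
by case: adj; rewrite ?IHy ?IHn ?orbT.
Qed.

Lemma toggle_subproof e G : e \in vpairs n ->
  (if e \in edges G then edges G :\ e else e |: edges G)%SET \subset vpairs n.
Proof.
move=> eP; case: ifP => _; last by rewrite finset.subUset finset.sub1set eP (valP G).
exact: fintype.subset_trans (finset.subsetDl _ _) (valP G).
Qed.

Definition toggle e (eP : e \in vpairs n) G : graph n := Sub _ (toggle_subproof e G eP).

Lemma mem_toggle e (eP : e \in vpairs n) G q :
  (q \in edges (toggle e eP G)) = (q == e) (+) (q \in edges G).
Proof.
rewrite /edges /toggle SubK -/(edges G).
by have [->|nqe] := eqVneq q e; case: ifP => eG; rewrite !inE ?eqxx ?eG ?(negPf nqe).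
Qed.

Lemma toggleK e (eP : e \in vpairs n) : involutive (toggle e eP).
Proof.
by move=> G; apply/val_inj/finset.setP => q; rewrite !mem_toggle addbA addbb.
Qed.

Definition determined_by (D : {set {set 'I_n}}) (h : graph n -> nat) : Prop :=
  forall G G', {in D, edges G =i edges G'} -> h G = h G'.

(** Toggling [e] is an involution on graphs that preserves [h] and exchanges presence and absence of
    [e]. *)
Lemma sum_toggle (D : {set {set 'I_n}}) (h : graph n -> nat) e :
    determined_by D h -> e \in vpairs n -> e \notin D ->
  \sum_G h G * (e \in edges G) = \sum_G h G * (e \notin edges G).
Proof.
move=> hD eP eD; rewrite (reindex_inj (inv_inj (toggleK e eP))).
apply: eq_bigr => G _; rewrite mem_toggle eqxx; congr (_ * _).
apply: hD => q qD; rewrite mem_toggle; case: eqP => [qe|//].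
by rewrite -qe qD in eD.
Qed.

(* A gambler who knows the vertices in [U] and the pairs in [D], and who learns
   the [j]-th queried pair when [T j], stakes everything at even odds on the
   presence of each new pair inside the set of known vertices. *)
Fixpoint wealth l (T : pred nat) (U : {set 'I_n}) (D : {set {set 'I_n}}) G : nat :=
  match l with
  | [::] => 1
  | e :: l' =>
      (if [&& e \in vpairs n, e \subset U & e \notin D] then 2 * (e \in edges G)
       else 1)
      * wealth l' (T \o succn) (if T 0 then U :|: e else U)%SET (e |: D)%SET G
  end.

(** The martingale property. The weight [h] carries the induction: it absorbs the bets already
    settled and the indicator of the branch taken, which depend only on the pairs in [D]. *)
Lemma sum_wealth s T U D (h : graph n -> nat) : determined_by D h ->
  \sum_G h G * wealth (trace s G) T U D G = \sum_G h G.
Proof.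
elim: s T U D h => [|u v yes IHy no IHn] T U D h hD.
  by apply: eq_bigr => G _; rewrite /= muln1.
pose e : {set 'I_n} := [set u; v]%SET.
pose T' : pred nat := T \o succn; pose U' : {set 'I_n} := (if T 0 then U :|: e else U)%SET.
pose bet G := if [&& e \in vpairs n, e \subset U & e \notin D]
  then 2 * (e \in edges G) else 1.
have hbetD (b : bool) :
    determined_by (e |: D)%SET (fun G => h G * bet G * ((e \in edges G) == b)).
  move=> G G' GG'; rewrite /bet (GG' e) ?finset.setU11 //; congr (_ * _ * _).
  by apply: hD => q qD; apply: GG'; rewrite inE qD orbT.
transitivity (\sum_G (h G * bet G * ((e \in edges G) == true)
      * wealth (trace yes G) T' U' (e |: D)%SET G
    + h G * bet G * ((e \in edges G) == false)
      * wealth (trace no G) T' U' (e |: D)%SET G)).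
  apply: eq_bigr => G _ /=; rewrite -/e -/(bet G) /adj -/e mulnA.
  by case: (e \in edges G); rewrite ?eqxx /= ?muln1 ?muln0 ?mul0n ?addn0 ?add0n.
rewrite big_split /= (IHy T' U' _ _ (hbetD true)) (IHn T' U' _ _ (hbetD false)).
rewrite -big_split /bet /=.
(* When a bet is placed, [e] is fresh, so both answers carry the same [h]-weight; doubling one and
   losing the other keeps the total. *)
have [/and3P[eP _ eD]|_] := boolP [&& _, _ & _]; last first.
  by apply: eq_bigr => G _; rewrite muln1; case: (e \in edges G); rewrite ?muln1 ?muln0 ?addn0.
transitivity (\sum_G (h G * (e \in edges G) + h G * (e \in edges G))).
  by apply: eq_bigr => G _; case: (e \in edges G); rewrite /= ?(muln1, muln0, mul0n, addn0, muln2, addnn).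
rewrite big_split /= {2}(sum_toggle _ _ _ hD eP eD) -big_split /=.
by apply: eq_bigr => G _; case: (e \in edges G); rewrite /= muln1 muln0 ?addn0.
Qed.

(** The known vertices stay inside the clique [V], so no bet is ever lost. Each pair of [C] wins
    one, since its ends are known before its first query. *)
Lemma wealth_ge l (T : pred nat) (U V : {set 'I_n}) (D C : {set {set 'I_n}}) G :
    (forall q, q \in vpairs n -> q \subset V -> q \in edges G) ->
    U \subset V ->
    (forall j, T j -> nth finset.set0 l j \subset V) ->
    (forall q, q \in C -> [/\ q \in vpairs n, q \in l, q \notin D &
      forall x, x \in q -> x \in U \/
        exists j, [/\ j < index q l, T j & x \in nth finset.set0 l j]]) ->
  2 ^ #|C| <= wealth l T U D G.
Proof.
move=> VG; elim: l T U D C => [|e l IH] T U D C UV TV CP.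
  suff -> : C = finset.set0 by rewrite cards0.
  by apply/finset.setP => q; rewrite inE; apply/negP => /CP[].
rewrite /= (cardsD1 e) expnD; apply: leq_mul.
  have [eC|eC] := boolP (e \in C).
    have [eP _ eD eU] := CP e eC.
    have esU : e \subset U.
      by apply/fintype.subsetP => x /eU[//|[j []]]; rewrite /= eqxx ltn0.
    by rewrite eP esU eD VG // (fintype.subset_trans esU UV).
  case: ifP => // /and3P[eP eU _].
  by rewrite VG // (fintype.subset_trans eU UV).
apply: IH.
- case: ifP => // T0; rewrite finset.subUset UV; exact: (TV 0 T0).
- by move=> j Tj; apply: (TV j.+1).
- move=> q; rewrite finset.in_setD1 => /andP[nqe /CP[qP]]; rewrite in_cons (negPf nqe) /=.
  move=> ql qD qU; split=> // [|x /qU[xU|]].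
  + by rewrite finset.in_setU1 negb_or nqe.
  + by left; case: ifP => // _; rewrite inE xU.
  + rewrite eq_sym (negPf nqe) => -[[|j] [jq Tj xj]]; last by right; exists j.
    by left; rewrite Tj inE xj orbT.
Qed.

End Betting.

(** * Late pairs of a clique and the union bound *)

Section Counting.
Local Open Scope nat_scope.

(** The pairs given up are the [m] rungs and, for any two rungs, one pair from each of the two
    perfect matchings between them: [m + 2 * 'C(m, 2) = m ^ 2]. *)
Lemma ex_late_pairs (V : finType) (K : {set V}) (m : nat) (r : {set V} -> nat) :
    m.*2 <= #|K| ->
    {in [pred q : {set V} | (q \subset K) && (#|q| == 2)] &, injective r} ->
  exists (v : 'I_m * bool -> V) (C : {set {set V}}),
    [/\ injective v, forall x, v x \in K, 'C(#|K|, 2) <= #|C| + m ^ 2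
      & forall q, q \in C -> [/\ q \subset K, #|q| == 2
          & forall i b, v (i, b) \in q -> r (rung v i) < r q]].
Proof.
move=> le_mK r_inj.
have [v [v_inj vK rung_single rung_cross]] := ex_early_matching V K m r le_mK r_inj.
(* For [i != j], [d] names a perfect matching between rungs [i] and [j]: it is the parity [b (+) c]
   shared by both pairs [v (i, b)], [v (j, c)] of that matching, and is symmetric in the two
   rungs. *)
pose earlier i j d :=
  if r [set v (i, false); v (j, d)]%SET <= r [set v (i, true); v (j, ~~ d)]%SET
  then [set v (i, false); v (j, d)]%SET else [set v (i, true); v (j, ~~ d)]%SET.
have earlierE i j b c :
    r [set v (i, b); v (j, c)]%SET < r [set v (i, ~~ b); v (j, ~~ c)]%SET ->
    earlier i j (b (+) c) = [set v (i, b); v (j, c)]%SET.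
  by rewrite /earlier; case: b; case: c => /= lt_r; rewrite ?(ltnW lt_r) // leqNgt lt_r.
(* The two orders of two edges of the matching stand for the two matchings
   between them. *)
pose lost (p : 'I_m * 'I_m) := earlier p.1 p.2 (~~ (p.1 < p.2)).
exists v, ([set q : {set V} | (q \subset K) && (#|q| == 2)] :\: lost @: [set: _])%SET.
split=> // [|q].
  rewrite -(cards_draws K 2) -(finset.cardsID (lost @: [set: _])%SET) addnC leq_add2l.
  apply: leq_trans (subset_leq_card (finset.subsetIr _ _)) _.
  apply: leq_trans (leq_imset_card _ _) _.
  by rewrite cardsT card_prod card_ord -mulnn.
rewrite !inE => /andP[q_kept /andP[qK q2]]; split=> // i b vq.
have [y nyv qE] : exists2 y, y != v (i, b) & q = [set v (i, b); y]%SET.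
  move: vq; have /cards2P[x [y [nxy ->]]] := q2.
  rewrite !inE => /orP[] /eqP->; first by exists y; rewrite // eq_sym.
  by exists x; rewrite // finset.setUC.
have yK : y \in K by move/fintype.subsetP: qK; apply; rewrite qE !inE eqxx orbT.
have [/existsP[[j c] /eqP yE]|] := boolP [exists x, y == v x]; last first.
  rewrite negb_exists => /forallP yv.
  by rewrite qE finset.setUC; apply: rung_single.
(* If [i = j], then [q] is rung [i] itself, which is the value of [lost] at [(i, i)]. *)
have [ij|nij] := eqVneq i j.
  case/negP: q_kept; apply/imsetP; exists (i, i) => //.
  have cE : c = ~~ b.
    by move: nyv; rewrite yE ij (inj_eq v_inj) xpair_eqE eqxx; case: (b); case: (c).
  rewrite qE yE -ij cE -rungE /lost /earlier /= ltnn /=.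
  by rewrite (finset.setUC [set v (i, true)]%SET) leqnn.
have := rung_cross i j b c nij; rewrite qE yE leq_max => /orP[//|lt_q'].
(* The partner of [q] in its matching comes after rung [i]. Either [q] is no earlier than this
   partner, or [q] is the earlier of the two and was given up. *)
have [le_q'q|lt_qq'] := leqP (r [set v (i, ~~ b); v (j, ~~ c)]%SET)
  (r [set v (i, b); v (j, c)]%SET); first exact: leq_trans lt_q' le_q'q.
case/negP: q_kept; apply/imsetP; rewrite qE yE.
have E1 := earlierE _ _ _ _ lt_qq'.
have E2 : earlier j i (b (+) c) = [set v (i, b); v (j, c)]%SET.
  rewrite addbC earlierE ?(finset.setUC [set v (j, c)]%SET) //.
  by rewrite (finset.setUC [set v (j, ~~ c)]%SET).
case: (ltngtP i j) => [ltij|ltji|/val_inj ij]; last by rewrite ij eqxx in nij.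
  case bc: (b (+) c) E1 E2 => E1 E2.
    by exists (j, i) => //; rewrite /lost /= ltnNge (ltnW ltij).
  by exists (i, j) => //; rewrite /lost /= ltij.
case bc: (b (+) c) E1 E2 => E1 E2.
  by exists (i, j) => //; rewrite /lost /= ltnNge (ltnW ltji).
by exists (j, i) => //; rewrite /lost /= ltji.
Qed.

(** Only the set of times matters: the gambler need not know which rung is queried at which time. *)
Definition times {m Q : nat} (t : 'I_m -> 'I_Q) : pred nat :=
  fun j => [exists i, t i == j :> nat].

(** The advice consists of the unmatched vertices of the clique and the first query times of the
    rungs; the factor [2 ^ (m ^ 2)] pays for the pairs that are not late. *)
Lemma clique_wealth (n : nat) (s : strategy n) (k m : nat) (G : graph n) :
    m.*2 <= k -> finds_clique s k G ->
  exists (W : {set 'I_n}) (t : {ffun 'I_m -> 'I_(num_queries s).+1}),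
    #|W| = k - m.*2 /\
    2 ^ 'C(k, 2) <= 2 ^ (m ^ 2) * wealth (trace s G) (times t) W finset.set0 G.
Proof.
move=> le_mk /existsP[K /andP[/eqP cardK /forall_inP K_clique]].
have K_pair (q : {set 'I_n}) : q \subset K -> #|q| == 2 -> (q \in trace s G) && (q \in edges G).
  move=> qK /cards2P[x [y [nxy qE]]]; rewrite mem_trace.
  have [xK yK] : x \in K /\ y \in K.
    by split; move/fintype.subsetP: qK; apply; rewrite qE !inE eqxx ?orbT.
  by have /forall_inP/(_ y yK) := K_clique x xK; rewrite nxy /= -qE /adj -qE.
pose r (q : {set 'I_n}) := index q (trace s G).
have r_inj : {in [pred q : {set 'I_n} | (q \subset K) && (#|q| == 2)] &, injective r}.
  move=> q q' /andP[qK q2] /andP[q'K q'2] rqq'.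
  have /andP[ql _] := K_pair q qK q2; have /andP[q'l _] := K_pair q' q'K q'2.
  by rewrite -(nth_index finset.set0 ql) -/(r q) rqq' nth_index.
rewrite -cardK in le_mk *.
have [v [C [v_inj vK leC CP]]] := ex_late_pairs _ K m r le_mk r_inj.
have rungK i : rung v i \subset K by rewrite finset.subUset !finset.sub1set !vK.
have rungl i : rung v i \in trace s G.
  suff /(K_pair _ (rungK i))/andP[] : #|rung v i| == 2 by [].
  by rewrite cards2 (inj_eq v_inj) xpair_eqE andbF.
exists (K :\: v @: [set: _])%SET, [ffun i => inord (r (rung v i))].
split.
  rewrite cardsDS; last by apply/fintype.subsetP => _ /imsetP[x _ ->].
  by rewrite card_imset // cardsT card_prod card_ord card_bool muln2.
(* [inord] does not fall back to its default: a query time is below the length of the trace. *)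
have tE i : (inord (r (rung v i)) : 'I_(num_queries s).+1) = r (rung v i) :> nat.
  rewrite inordK // ltnS; apply: leq_trans (size_trace s G).
  by apply: ltnW; rewrite index_mem rungl.
apply: (@leq_trans (2 ^ (m ^ 2) * 2 ^ #|C|)); first by rewrite -expnD leq_exp2l // addnC.
rewrite leq_mul2l; apply/orP; right; apply: (wealth_ge _ _ _ K).
- by move=> q qP qK; rewrite inE in qP; have /andP[] := K_pair q qK qP.
- exact: finset.subsetDl.
- by move=> j /existsP[i]; rewrite ffunE tE => /eqP<-; rewrite nth_index ?rungl ?rungK.
- move=> q /CP[qK q2 qlate]; have /andP[ql _] := K_pair q qK q2.
  split=> //; rewrite ?inE // => x xq.
  have xK : x \in K by move/fintype.subsetP: qK; apply.
  have [/imsetP[[i b] _ xE]|xv] := boolP (x \in v @: [set: _])%SET; last first.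
    by left; rewrite inE xv.
  right; exists (r (rung v i)); split.
  + by apply: (qlate i b); rewrite -xE.
  + by apply/existsP; exists i; rewrite ffunE tE.
  + by rewrite nth_index ?rungl // (rungE _ i b) xE !inE eqxx.
Qed.

Lemma leq_bin_expn (n j : nat) : 'C(n, j) <= n ^ j.
Proof.
apply: leq_trans (_ : n ^_ j <= _).
  by rewrite -bin_ffact leq_pmulr // fact_gt0.
by elim: j => // j IH; rewrite ffactnSr expnSr leq_mul // leq_subr.
Qed.

(** Markov's inequality, summed over all advice [(W, t)]: for each of them, the wealth summed over
    all graphs is the number of graphs. *)
Lemma card_finds_clique (n : nat) (s : strategy n) (k m : nat) : m.*2 <= k ->
  #|[pred G | finds_clique s k G]| * 2 ^ 'C(k, 2) <=
  n ^ (k - m.*2) * (num_queries s).+1 ^ m * 2 ^ (m ^ 2) * #|{: graph n}|.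
Proof.
move=> le_mk; rewrite -sum_nat_const.
apply: (@leq_trans (\sum_G \sum_(W : {set 'I_n} | #|W| == k - m.*2)
    \sum_(t : {ffun 'I_m -> 'I_(num_queries s).+1})
    2 ^ (m ^ 2) * wealth (trace s G) (times t) W finset.set0 G)).
  rewrite big_mkcond /=; apply: leq_sum => G _; case: ifP => // findG.
  have [W [t [cardW le_wealth]]] := clique_wealth _ _ _ _ _ le_mk findG.
  rewrite (bigD1 W) ?cardW //= (bigD1 t) //= -addnA.
  exact: leq_trans le_wealth (leq_addr _ _).
rewrite exchange_big /=.
under eq_bigr => W _.
  rewrite exchange_big /=.
  under eq_bigr => t _.
    rewrite (sum_wealth _ _ _ _ (fun _ => 2 ^ (m ^ 2))) // sum_nat_const.
    over.
  rewrite sum_nat_const.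
  over.
rewrite sum_nat_const card_ffun !card_ord -!mulnA; apply: leq_mul.
  apply: leq_trans (leq_bin_expn _ _).
  by rewrite -[n in 'C(n, _)]card_ord -card_draws cardsE; apply/eq_leq/eq_card.
by rewrite leq_mul2l mulnC leq_mul2l; do 2![apply/orP; right]; apply/eq_leq/eq_card.
Qed.

End Counting.

(** * From counting graphs to an inequality between exponents *)

Lemma gnp_prob_half (R : realType) (n : nat) (A : pred (graph n)) :
  gnp_prob (2^-1 : R) A * #|{: graph n}|%:R = #|[pred G | A G]|%:R.
Proof.
have halfE (B : pred (graph n)) :
    gnp_prob (2^-1 : R) B = #|[pred G | B G]|%:R * 2^-1 ^+ #|vpairs n|.
  rewrite /gnp_prob mulr_natl -sumr_const; apply: eq_bigr => G _.
  have -> : 1 - 2^-1 = 2^-1 :> R by field.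
  by rewrite -exprD subnKC // subset_leq_card // (valP G).
have := @gnp_prob_predT R n 2^-1; rewrite halfE => predT1.
have cardT : #|{: graph n}| = #|[pred G : graph n | predT G]| by apply: eq_card.
by rewrite halfE cardT -mulrA [_ ^+ _ * _]mulrC predT1 mulr1.
Qed.

Lemma prob_finds_clique (R : realType) (n : nat) (s : strategy n) (k m : nat) :
    (m.*2 <= k)%N ->
  gnp_prob (2^-1 : R) (finds_clique s k) * 2 ^+ 'C(k, 2) <=
  n%:R ^+ (k - m.*2) * (num_queries s).+1%:R ^+ m * 2 ^+ (m ^ 2).
Proof.
move=> le_mk; have := card_finds_clique n s k m le_mk.
have graph_gt0 : (0 < #|{: graph n}|)%N.
  by apply/card_gt0P; exists (Sub finset.set0 (finset.sub0set _)).
rewrite -(ler_nat R) !natrM !natrX -gnp_prob_half.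
by rewrite mulrAC ler_pM2r // ltr0n.
Qed.

Lemma lg_queries_bound (R : realType) (delta : R) (n : nat) (s : strategy n) (k m : nat) :
    (0 < n)%N -> 0 <= delta -> (m.*2 <= k)%N ->
    (num_queries s)%:R <= n%:R `^ delta ->
    2^-1 <= gnp_prob (2^-1 : R) (finds_clique s k) ->
  k%:R * (k%:R - 1) / 2 - 1 <=
  (k%:R - 2 * m%:R) * lg n%:R + m%:R * (1 + delta * lg n%:R) + m%:R ^+ 2.
Proof.
move=> n_gt0 delta_ge0 le_mk le_Q half_le.
have ln2_gt0 : 0 < ln 2 :> R by rewrite ln_gt0 // ltr1n.
have nR_gt0 : 0 < n%:R :> R by rewrite ltr0n.
have nd_ge1 : 1 <= n%:R `^ delta :> R by rewrite -[leLHS](powRr0 n%:R) ler_powR // ler1n.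
have le_Q1 : (num_queries s).+1%:R <= 2 * n%:R `^ delta.
  by rewrite -natr1; lra.
have le_pow : 2^-1 * 2 ^+ 'C(k, 2) <=
    n%:R ^+ (k - m.*2) * (2 * n%:R `^ delta) ^+ m * 2 ^+ (m ^ 2).
  apply: le_trans (le_trans (prob_finds_clique R n s k m le_mk) _).
    by rewrite ler_wpM2r // exprn_ge0.
  rewrite ler_wpM2r ?exprn_ge0 // ler_wpM2l ?exprn_ge0 ?ler0n //.
  by rewrite lerXn2r // nnegrE ?ler0n // mulr_ge0 // powR_ge0.
have pow2_gt0 j : 0 < 2 ^+ j :> R by rewrite exprn_gt0.
have nd_gt0 : 0 < 2 * n%:R `^ delta :> R by rewrite mulr_gt0 // powR_gt0.
have lnn : ln n%:R = lg n%:R * ln 2 :> R by rewrite /lg divfK // gt_eqF.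
move: le_pow; rewrite -ler_ln ?posrE ?mulr_gt0 ?exprn_gt0 ?invr_gt0 //.
rewrite !lnM ?posrE ?mulr_gt0 ?exprn_gt0 ?invr_gt0 ?powR_gt0 //.
have lnX (x : R) j : 0 < x -> ln (x ^+ j) = j%:R * ln x.
  by move=> x_gt0; rewrite lnXn // mulr_natl.
rewrite !lnX // lnV ?posrE // lnM ?posrE ?powR_gt0 // ln_powR lnn.
rewrite natrB // -muln2 natrM natrX.
have -> : 'C(k, 2)%:R = k%:R * (k%:R - 1) / 2 :> R.
  case: k {le_mk half_le} => [|k]; first by rewrite bin0n mulr0n !mul0r.
  apply: (mulIf (_ : 2 != 0)) => //; rewrite divfK // -natrM.
  rewrite bin2 /= muln2 halfK mulnC oddM /= andbN subn0 natrM -natr1; ring.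
move=> le_ln; rewrite -(ler_pM2r ln2_gt0); move: le_ln; lra.
Qed.

(** * Choice of the parameters and conclusion *)

(** Twice the right side minus the left is [(k - L)^2 - L^2 + 2 mu^2 L^2 - 2 (m - mu L)^2 - k - 2 m
    - 2]. Its main term is [c L^2 >= 10 L]; rounding and the linear terms cost at most [6 L + 3]. *)
Lemma quadratic_exponent_lt (R : realType) (alpha mu L k m : R) :
    1 < alpha -> alpha <= 2 -> 0 <= mu -> mu <= 1 ->
    0 < (alpha - 1) ^+ 2 + 2 * mu ^+ 2 - 1 ->
    1 <= L -> 1 <= (alpha - 1) * L ->
    10 <= ((alpha - 1) ^+ 2 + 2 * mu ^+ 2 - 1) * L ->
    k <= alpha * L -> alpha * L < k + 1 -> m <= mu * L -> mu * L < m + 1 ->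
  (k - 2 * m) * L + m * (1 + (2 - 2 * mu) * L) + m ^+ 2 < k * (k - 1) / 2 - 1.
Proof.
set c := (X in 0 < X) => a1 a2 mu0 mu1 c_gt0 L1 aL1 cL k_le k_gt m_le m_gt.
have m_sq : (m - mu * L) ^+ 2 <= 1.
  by rewrite expr2; nra.
have k_sq : ((alpha - 1) * L - 1) ^+ 2 <= (k - L) ^+ 2.
  by rewrite lerXn2r ?nnegrE; lra.
have cL2 : 10 * L <= c * L * L by rewrite ler_wpM2r //; lra.
have alphaL : alpha * L <= 2 * L by rewrite ler_wpM2r //; lra.
have muL : mu * L <= L by rewrite -{2}[L]mul1r ler_wpM2r //; lra.
move: m_sq k_sq cL2; rewrite /c; lra.
Qed.

Lemma ex_large_lg (R : realType) (N : nat) (B : R) :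
  exists n : nat, [/\ (N <= n)%N, (0 < n)%N & B <= lg n%:R].
Proof.
pose p := (Num.truncn B).+1.
have ln2_gt0 : 0 < ln 2 :> R by rewrite ln_gt0 // ltr1n.
exists (maxn N (2 ^ p)); split; first exact: leq_maxl.
  by rewrite leq_max expn_gt0 orbT.
apply: (@le_trans _ _ p%:R); first exact/ltW/truncnS_gt.
rewrite /lg ler_pdivlMr // mulr_natl -lnXn // -natrX ler_ln ?posrE ?ltr0n ?expn_gt0 //.
  by rewrite ler_nat leq_maxr.
by rewrite leq_max expn_gt0 orbT.
Qed.

Theorem theorem3 (R : realType) (delta : R)
    (hdelta1 : 2 / 3 < delta) (hdelta2 : delta < 2) :
  alpha_star delta <= 1 + Num.sqrt (1 - (2 - delta) ^+ 2 / 2) /\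
  1 + Num.sqrt (1 - (2 - delta) ^+ 2 / 2) < 2.
Proof.
pose mu := (2 - delta) / 2.
have mu_gt0 : 0 < mu by rewrite /mu; lra.
have mu_lt : mu < 2 / 3 by rewrite /mu; lra.
have -> : 1 - (2 - delta) ^+ 2 / 2 = 1 - 2 * mu ^+ 2 by rewrite /mu; field.
(* [1 / 9] is the value at [mu = 2 / 3], that is, at [delta = 2 / 3]. *)
have x_ge : 1 / 9 <= 1 - 2 * mu ^+ 2 by rewrite expr2; nra.
split; last first.
  suff : Num.sqrt (1 - 2 * mu ^+ 2) < 1 by lra.
  by rewrite -[ltRHS]sqrtr1 ltr_sqrt // ltrBlDr ltrDl mulr_gt0 // exprn_gt0.
apply: ge_sup; first by have [] := achievable_has_sup delta.
move=> alpha [alpha_le2 [N _ winning]]; rewrite leNgt; apply/negP => alpha_gt.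
pose sq := Num.sqrt (1 - 2 * mu ^+ 2).
have sq_ge0 : 0 <= sq by exact: sqrtr_ge0.
have sqE : sq ^+ 2 = 1 - 2 * mu ^+ 2 by rewrite sqr_sqrtr //; lra.
have alpha_gt' : sq < alpha - 1 by rewrite /sq; lra.
pose c := (alpha - 1) ^+ 2 + 2 * mu ^+ 2 - 1.
have c_gt0 : 0 < c.
  have : sq ^+ 2 < (alpha - 1) ^+ 2 by rewrite ltrXn2r // nnegrE; lra.
  by rewrite /c; lra.
(* Hence [alpha > 4 / 3 > 2 * mu], which makes room for the matching in the clique. *)
have sq_ge : 1 / 3 <= sq by rewrite leNgt; apply/negP => sq_lt; nra.
(* The [3] ensures [1 <= (alpha - 1) * L], as [alpha - 1 > 1 / 3]; the [10 / c] ensures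
   [10 <= c * L]. *)
have [n [leNn n_gt0 L_ge]] := ex_large_lg R N (3 + 10 / c).
set L := lg n%:R in L_ge.
have cinv_gt0 : 0 < 10 / c by rewrite divr_gt0.
have L_ge3 : 3 <= L by lra.
have cL : 10 <= c * L.
  have : c * (3 + 10 / c) <= c * L by rewrite ler_wpM2l // ltW.
  by rewrite mulrDr mulrCA divff ?gt_eqF //; lra.
have [s [le_Q half_le]] := winning n leNn.
rewrite -/L in half_le; set k := Num.truncn _ in half_le.
pose m := Num.truncn (mu * L).
have /andP[k_le k_gt] : k%:R <= alpha * L < k.+1%:R by apply: truncn_itv; nra.
have /andP[m_le m_gt] : m%:R <= mu * L < m.+1%:R by apply: truncn_itv; nra.
have le_mk : (m.*2 <= k)%N.
  rewrite /k truncn_ge_nat; last by nra.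
  by rewrite -muln2 natrM; nra.
have delta_ge0 : 0 <= delta by lra.
have := lg_queries_bound R delta n s k m n_gt0 delta_ge0 le_mk le_Q half_le.
apply/negP; rewrite -ltNge -/L.
have -> : delta = 2 - 2 * mu by rewrite /mu; field.
rewrite -natr1 in k_gt; rewrite -natr1 in m_gt.
apply: (quadratic_exponent_lt R alpha) => //; try lra.
by nra.
Qed.
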